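(* Let $\mathfrak{B}(\mathcal{A},\mathcal{B},\mathcal{C},\mathcal{D})$ be a controllable linear system evolving in the duals of reproducing kernel Hilbert spaces, given by $$f_{i+1}=\mathcal{A}f_i+\mathcal{B}E_{u_i},\qquad E_{y_i}=\mathcal{C}f_i+\mathcal{D}E_{u_i},$$ and let $\{u_i\}_{i=1}^{T}$, $\{y_i\}_{i=1}^{T}$ be a measured input-output sequence of this system. Let $L\ge 1$, $n=T-L+1$, and let $v_1,\dots,v_n$ be the columns of the stacked Hankel matrix $\mathfrak{H}_L(E_u,E_y)$, with Gram matrix $K\in\mathbb{R}^{n\times n}$, $K_{i,j}=k(v_i,v_j)$. Assume that $E_u=\{E_{u_i}\}_{i=1}^T$ is persistently exciting of order $N\ge \mathfrak{O}(\mathfrak{B}(\mathcal{A},\mathcal{B},\mathcal{C},\mathcal{D}))+Ln_u$. Let $\{\tilde u_i\}_{i=1}^{L}$, $\{\tilde y_i\}_{i=1}^{L}$ be a sequence of inputs and outputs of length $L$ and put $\tilde v:=v(\{\tilde u_i\}_{i=1}^L,\{\tilde y_i\}_{i=1}^L)$. Then $\{\tilde u_i\}_{i=1}^{L}$, $\{\tilde y_i\}_{i=1}^{L}$ is an element of $\mathfrak{B}_L(\mathcal{A},\mathcal{B},\mathcal{C},\mathcal{D})$ if and only if there exists $g=(g_1,\dots,g_n)^\top\in\mathbb{R}^n$ such that $$g^\top K g+k(\tilde v,\tilde v)-2\sum_{i=1}^n g_i\,k(\tilde v,v_i)=0 .$$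
   Context: Spaces. $H_x,H_u,H_y$ are reproducing kernel Hilbert spaces (RKHS) of real-valued functions; $H_u$ consists of functions on the input space $\mathbb{R}^{n_u}$ and has kernel $k_u(\cdot,\cdot)$, $H_y$ consists of functions on the output space $\mathbb{R}^{n_y}$ and has kernel $k_y(\cdot,\cdot)$. For a Hilbert space $H$, $H^*$ is the dual space of bounded linear functionals. For an input $u$, $E_u\in H_u^*$ is the evaluation functional $E_u h=h(u)$; for an output $y$, $E_y\in H_y^*$ is the evaluation functional $E_y h=h(y)$. Thus $\langle E_u,E_{u'}\rangle_{H_u^*}=k_u(u,u')$ and $\langle E_y,E_{y'}\rangle_{H_y^*}=k_y(y,y')$. System. The states $f_i$ lie in $H_x^*$, and $\mathcal{A}:H_x^*\to H_x^*$, $\mathcal{B}:H_u^*\to H_x^*$, $\mathcal{C}:H_x^*\to H_y^*$, $\mathcal{D}:H_u^*\to H_y^*$ are bounded linear operators. The order $\mathfrak{O}(\mathfrak{B}(\mathcal{A},\mathcal{B},\mathcal{C},\mathcal{D}))$ is the order of the system, i.e. the dimension of its state space. Controllability is the usual notion for the linear system with state space $H_x^*$ and input space $H_u^*$. $\mathfrak{B}_L(\mathcal{A},\mathcal{B},\mathcal{C},\mathcal{D})$ is the collection of all $L$-step input-output trajectories of the linear system; a sequence $\{\tilde u_i\}_{i=1}^L,\{\tilde y_i\}_{i=1}^L$ is said to be an element of it if the sequences of evaluation functionals $\{E_{\tilde u_i}\}_{i=1}^L,\{E_{\tilde y_i}\}_{i=1}^L$ form such a trajectory, i.e. satisfy the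 system equations for some state sequence in $H_x^*$. The measured sequence $\{u_i\}_{i=1}^T,\{y_i\}_{i=1}^T$ is a $T$-step trajectory in this sense. Hankel matrices. For a sequence $s=\{s_i\}_{i=1}^T$, the depth-$L$ Hankel matrix $\mathfrak{H}_L(s)$ has $T-L+1$ columns, the $j$-th column being $(s_j,s_{j+1},\dots,s_{j+L-1})^\top$. $\mathfrak{H}_L(E_u)$ and $\mathfrak{H}_L(E_y)$ are the Hankel matrices of the sequences $\{E_{u_i}\}_{i=1}^T$ and $\{E_{y_i}\}_{i=1}^T$, and $\mathfrak{H}_L(E_u,E_y)$ is obtained by stacking $\mathfrak{H}_L(E_u)$ on top of $\mathfrak{H}_L(E_y)$. The sequence $E_u$ is persistently exciting of order $N$ if $\mathfrak{H}_N(E_u)$ has full row rank, i.e. as a linear map $\mathbb{R}^{T-N+1}\to (H_u^* )^N$ it is surjective. Kernel on trajectories. For inputs $a_1,\dots,a_L$ and outputs $b_1,\dots,b_L$ write $v(\{a_i\}_{i=1}^L,\{b_i\}_{i=1}^L):=[E_{a_1},\dots,E_{a_L},E_{b_1},\dots,E_{b_L}]^\top$, an element of the product of $L$ copies of $H_u^*$ and $L$ copies of $H_y^*$. The $j$-th column of $\mathfrak{H}_L(E_u,E_y)$ is $v_j=v(\{u_{j+i-1}\}_{i=1}^L,\{y_{j+i-1}\}_{i=1}^L)$. The kernel $k$ is the sum of componentwise inner products: $$k\big(v(\{a_i\},\{b_i\}),v(\{a'_i\},\{b'_i\})\big)=\sum_{i=1}^{L}k_u(a_i,a'_i)+\sum_{i=1}^{L}k_y(b_i,b'_i).$$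 *)

(* Defs.v *)
From HB Require Import structures.
From mathcomp Require Import all_boot all_order all_algebra.
From mathcomp Require Import sesquilinear.
From mathcomp Require Import all_classical all_reals all_analysis.
From mathcomp Require Import ring lra.

Set Implicit Arguments.
Unset Strict Implicit.
Unset Printing Implicit Defensive.

Import Order.TTheory GRing.Theory Num.Theory.
Import numFieldNormedType.Exports.

Local Open Scope classical_set_scope.
Local Open Scope ring_scope.

(* The dual of V; as a normed space it carries the operator norm. *)
Section Dual.
Variables (R : realType) (V : normedModType R).

Definition bounded_functional : {pred V -> R^o} :=
  [pred f | `[< linear f /\ continuous f >] ].

Record dual := Dual {
  dual_fun :> V -> R^o;
  dual_funP : dual_fun \in bounded_functional }.

HB.instance Definition _ := [isSub for dual_fun].
HB.instance Definition _ := [Choice of dual by <:].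

Lemma bounded_functional_submod : submod_closed bounded_functional.
Proof.
split=> [|a f g /asboolP[lf cf] /asboolP[lg cg]]; apply/asboolP; split.
- by move=> a u v; rewrite /= scaler0 addr0.
- exact: cst_continuous.
- move=> b u v; rewrite !fctE lf lg !scalerDr !scalerA [b * a]mulrC addrACA.
  by [].
- move=> x; apply: continuousD; last exact: cg.
  by apply: cvgZr; exact: cf.
Qed.

HB.instance Definition _ :=
  GRing.isSubmodClosed.Build R (V -> R^o) bounded_functional
    bounded_functional_submod.
HB.instance Definition _ := [SubChoice_isSubLmodule of dual by <:].

Implicit Types f g : dual.

Lemma dual_linear f : linear f.
Proof. by case: f => f /= /asboolP[]. Qed.

HB.instance Definition _ f := GRing.isLinear.Build R V R^o *:%R f (dual_linear f).

Lemma dual_continuous f : continuous f.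
Proof. by case: f => f /= /asboolP[]. Qed.

Lemma dualDE f g x : (f + g) x = f x + g x. Proof. by []. Qed.

Lemma dualZE a f x : (a *: f) x = a * f x. Proof. by []. Qed.

Definition opnorm f : R := sup [set `|f x| | x in [set x : V | `|x| <= 1]].

Lemma opnorm_has_sup f : has_sup [set `|f x| | x in [set x : V | `|x| <= 1]].
Proof.
split; first by exists `|f 0|; exists 0 => //=; rewrite normr0.
have /linear_boundedP/pinfty_ex_gt0[r r0 fr] := (continuous_linear_bounded 0 (@dual_continuous f 0)).
exists r => _ [x /= x1 <-]; apply: (le_trans (fr x)).
by rewrite ler_piMr// ltW.
Qed.

Lemma opnorm_ub f x : `|x| <= 1 -> `|f x| <= opnorm f.
Proof.
by move=> x1; apply: (ub_le_sup (opnorm_has_sup f).2); exists x.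
Qed.

Lemma opnorm_le f M : (forall x, `|x| <= 1 -> `|f x| <= M) -> opnorm f <= M.
Proof.
by move=> fM; apply: (ge_sup (opnorm_has_sup f).1) => _ [x x1 <-]; exact: fM.
Qed.

Lemma opnormD f g : opnorm (f + g) <= opnorm f + opnorm g.
Proof.
apply: opnorm_le => x x1; rewrite (le_trans (ler_normD _ _))//.
by rewrite lerD// opnorm_ub.
Qed.

Let opnormZ_le a f : opnorm (a *: f) <= `|a| * opnorm f.
Proof.
by apply: opnorm_le => x x1; rewrite normrM ler_wpM2l// opnorm_ub.
Qed.

Lemma opnormZ a f : opnorm (a *: f) = `|a| * opnorm f.
Proof.
apply/eqP; rewrite eq_le opnormZ_le/=.
have [->|a0] := eqVneq a 0.
  rewrite normr0 mul0r.
  have := @opnorm_ub (0 *: f) 0; rewrite normr0 => /(_ ler01).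
  exact: le_trans.
rewrite -[f in leLHS]scale1r -(mulVf a0) -scalerA.
rewrite (le_trans (ler_wpM2l (normr_ge0 a) (opnormZ_le a^-1 (a *: f))))//.
by rewrite mulrA -normrM divff// normr1 mul1r.
Qed.

Lemma opnorm_eq0 f : opnorm f = 0 -> f = 0.
Proof.
move=> f0; apply/val_inj/funext => x /=.
have [->|x0] := eqVneq x 0; first exact: linear0.
have : `|f (`|x|^-1 *: x)| <= 0.
  rewrite -f0; apply: opnorm_ub.
  by rewrite normrZ normfV normr_id mulVf// normr_eq0.
rewrite linearZ/= normrM pmulr_rle0; last by rewrite normr_gt0 invr_eq0 normr_eq0.
by rewrite normr_le0 => /eqP.
Qed.

HB.instance Definition _ :=
  Lmodule_isNormed.Build R dual opnormD opnormZ opnorm_eq0.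

Lemma dual_normE f :
  `|f| = sup [set `|f x| | x in [set x : V | `|x| <= 1]] :> R.
Proof. by []. Qed.

End Dual.

(* A Hilbert space of functions X -> R is encoded as an abstract complete normed
   space together with an injective linear map [rkhs_eval] to functions; the
   norm comes from a real inner product.  [rkhs_section x] is the function
   k(x, .), as an element of the space. *)
Record rkhs (R : realType) (X : Type) := Rkhs {
  rkhs_space :> completeNormedModType R;
  rkhs_dot : {dot rkhs_space for idfun};
  rkhs_normE : forall h : rkhs_space, `|h| ^+ 2 = rkhs_dot h h;
  rkhs_eval : rkhs_space -> X -> R;
  rkhs_evalP : forall a g h x,
    rkhs_eval (a *: g + h) x = a * rkhs_eval g x + rkhs_eval h x;
  rkhs_eval_inj : injective rkhs_eval;
  rkhs_section : X -> rkhs_space;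
  rkhs_reproducing : forall h x, rkhs_eval h x = rkhs_dot h (rkhs_section x) }.

Section RKHS.
Variables (R : realType) (X : Type) (H : rkhs R X).

Definition rkhs_kernel (x y : X) : R := rkhs_eval (rkhs_section H x) y.

Local Notation "''[' u , v ]" := (rkhs_dot H u v) : ring_scope.

Lemma rkhs_dotC (g h : H) : '[g, h] = '[h, g].
Proof. by rewrite hermC /= expr0 mul1r. Qed.

Lemma rkhs_kernelE x y :
  rkhs_kernel x y = '[rkhs_section H x, rkhs_section H y].
Proof. exact: rkhs_reproducing. Qed.

Lemma rkhs_dotZD (t : R) (g h : H) :
  '[g + t *: h, g + t *: h] = '[g, g] + t *+ 2 * '[g, h] + t ^+ 2 * '[h, h].
Proof.
rewrite linearDl/= !linearDr/= !linearZl_LR/= !linearZr_LR/= (rkhs_dotC h g).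
ring.
Qed.

Lemma rkhs_norm_dot (g h : H) : `|'[g, h]| <= `|g| * `|h|.
Proof.
have [->|h0] := eqVneq h 0.
  by rewrite linear0r normr0 mulr_ge0.
have hh : 0 < '[h, h] by rewrite -rkhs_normE exprn_gt0 ?normr_gt0.
set t := - '[g, h] / '[h, h].
have : 0 <= '[g + t *: h, g + t *: h] by rewrite -rkhs_normE exprn_ge0.
rewrite rkhs_dotZD => H0.
have : '[g, h] ^+ 2 <= '[g, g] * '[h, h].
  have -> : '[g, g] * '[h, h] = '[g, h] ^+ 2 +
    ('[g, g] + t *+ 2 * '[g, h] + t ^+ 2 * '[h, h]) * '[h, h].
    by rewrite /t; field; rewrite gt_eqF.
  by rewrite lerDl mulr_ge0// ltW.
rewrite -!rkhs_normE -exprMn -real_normK ?num_real//.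
by rewrite ler_pXn2r// nnegrE mulr_ge0.
Qed.

Lemma rkhs_evaluation_bounded (x : X) :
  (fun h : H => rkhs_eval h x) \in @bounded_functional R H.
Proof.
have evl : linear (fun h : H => rkhs_eval h x : R^o).
  by move=> a g h; exact: rkhs_evalP.
apply/asboolP; split=> //.
pose ev : {linear H -> R^o} :=
  HB.pack (fun h : H => rkhs_eval h x : R^o) (GRing.isLinear.Build R H R^o *:%R _ evl).
apply: (@bounded_linear_continuous _ _ _ ev); apply/linear_boundedP.
near=> r => h; rewrite /= rkhs_reproducing (le_trans (rkhs_norm_dot _ _))//.
by rewrite mulrC ler_wpM2r//; near: r; exact: nbhs_pinfty_ge.
Unshelve. all: by end_near. Qed.

Definition evaluation (x : X) : dual H := Dual (rkhs_evaluation_bounded x).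

Let J (f : dual H) (h : H) : R := '[h, h] - 2 * f h.

Lemma dual_norm_ge (f : dual H) h : `|f h| <= `|f| * `|h|.
Proof.
have [->|h0] := eqVneq h 0; first by rewrite linear0 !normr0 mulr0.
have := @opnorm_ub _ _ f (`|h|^-1 *: h).
rewrite normrZ normfV normr_id mulVf ?normr_eq0// => /(_ (lexx _)).
rewrite linearZ/= normrM normfV normr_id ler_pdivrMl ?normr_gt0//.
by rewrite mulrC.
Qed.

Let J_ge (f : dual H) h : - `|f| ^+ 2 <= J f h.
Proof.
rewrite /J -rkhs_normE.
have := dual_norm_ge f h; have := ler_norm (f h).
set a : R := `|f|; set b : R := `|h|; set c : R := `|f h|; set d : R := f h.
by have := sqr_ge0 (a - b); rewrite sqrrB => ? ? ?; lra.
Qed.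

Let J_inf (f : dual H) : has_inf (range (J f)).
Proof.
split; first by exists (J f 0), 0.
by exists (- `|f| ^+ 2) => _ [h _ <-]; exact: J_ge.
Qed.

Let J_ge_inf (f : dual H) h : inf (range (J f)) <= J f h.
Proof. by apply: (ge_inf (J_inf f).2); exists h. Qed.

Let J_parallelogram (f : dual H) g h :
  `|g - h| ^+ 2 = 2 * J f g + 2 * J f h - 4 * J f (2^-1 *: (g + h)).
Proof.
have -> : g - h = g + (-1) *: h by rewrite scaleN1r.
have -> : g + h = g + 1 *: h by rewrite scale1r.
have dZ : '[2^-1 *: (g + 1 *: h), 2^-1 *: (g + 1 *: h)] =
    2^-1 ^+ 2 * '[g + 1 *: h, g + 1 *: h].
  by rewrite -!rkhs_normE normrZ exprMn real_normK ?num_real.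
have fZ : f (2^-1 *: (g + 1 *: h)) = 2^-1 * (f g + f h).
  by rewrite scale1r linearZ/= linearD.
by rewrite /J dZ fZ rkhs_normE !rkhs_dotZD; field.
Qed.

Let J_cont (f : dual H) : continuous (J f).
Proof.
have -> : J f = (fun h => `|h| ^+ 2 - 2 * f h).
  by apply/funext => h; rewrite rkhs_normE.
move=> h; apply: (@cvgB _ R^o _ (nbhs h) _ (fun h => `|h| ^+ 2)).
  apply: (@cvgM _ _ (nbhs h) _ (fun h => `|h|) (fun h => `|h|)).
    exact: norm_continuous.
  exact: norm_continuous.
apply: (@cvgM _ _ (nbhs h) _ (fun=> 2) f); first exact: cvg_cst.
exact: dual_continuous.
Qed.

Theorem riesz (f : dual H) : exists r : H, forall h, f h = '[h, r].
Proof.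
set m := inf (range (J f)).
have J_near (e : R) : 0 < e -> exists h, J f h < m + e.
  by move=> e0; have [_ [h _ <-]] := inf_adherent e0 (J_inf f); exists h.
pose F : set_system H := filter_from [set e : R | 0 < e]
  (fun e => [set h | J f h < m + e]).
have FF : ProperFilter F.
  apply: filter_from_proper; last first.
    by move=> e e0; have [h ?] := J_near e e0; exists h.
  apply: filter_from_filter; first by exists 1 => /=.
  move=> a b /= a0 b0; exists (Num.min a b); first by rewrite /= lt_min a0.
  by move=> h /= ; rewrite -ltrBlDl lt_min !ltrBlDl => /andP[].
have : cauchy F.
  apply/cauchy_ballP => e e0.
  pose d := e ^+ 2 / 4.
  have d0 : 0 < d by rewrite divr_gt0 ?exprn_gt0.
  exists ([set h | J f h < m + d], [set h | J f h < m + d]).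
    by split; exists d.
  move=> [g h] /= [Jg Jh]; rewrite -ball_normE/=.
  rewrite -(ltr_pXn2r (_ : 0 < 2)%N) ?nnegrE// ?(ltW e0)// (J_parallelogram f).
  have := J_ge_inf f (2^-1 *: (g + h)); rewrite -/m.
  have : d * 4 = e ^+ 2 by rewrite /d divfK.
  by move=> <-; lra.
move=> /cauchy_cvg /cvg_ex[r Fr].
have Jr : J f r <= m.
  apply/ler_addgt0Pr => e e0.
  have Jc : J f h @[h --> F] --> J f r.
    apply: (cvg_trans (cvg_app (J f) Fr)).
    exact: (@J_cont f r).
  apply: (closed_cvg [set y : R | y <= m + e] _ _ _ Jc).
    exact: closed_le.
  by exists e => //= h /ltW.
exists r => h.
have var (t : R) : 0 <= t * 2 * ('[h, r] - f h) + t ^+ 2 * '[h, h].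
  have := le_trans Jr (J_ge_inf f (r + t *: h)).
  have fE : f (r + t *: h) = f r + t * f h by rewrite linearD linearZ.
  rewrite /J fE rkhs_dotZD (rkhs_dotC r h) -subr_ge0.
  by congr (0 <= _); ring.
apply/eqP; rewrite -subr_eq0; apply/eqP.
have [h0|h0] := eqVneq h 0; first by rewrite h0 linear0 linear0l subrr.
have hh : 0 < '[h, h] by rewrite -rkhs_normE exprn_gt0 ?normr_gt0.
have := var (- ('[h, r] - f h) / '[h, h]).
set a := '[h, r] - f h; set b := '[h, h].
have -> : - a / b * 2 * a + (- a / b) ^+ 2 * b = - (a ^+ 2 / b).
  by field; rewrite gt_eqF.
rewrite oppr_ge0 pmulr_lle0 ?invr_gt0// => a2.
have /eqP : a ^+ 2 = 0 by apply/eqP; rewrite eq_le a2 sqr_ge0.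
by rewrite sqrf_eq0 => /eqP a0; rewrite -opprB -/a a0 oppr0.
Qed.

Definition riesz_rep (f : dual H) : H := sval (cid (riesz f)).

Lemma riesz_repP (f : dual H) h : f h = '[h, riesz_rep f].
Proof. by rewrite /riesz_rep; case: cid. Qed.

Definition dual_dot (f g : dual H) : R := '[riesz_rep f, riesz_rep g].

Lemma riesz_rep_evaluation x : riesz_rep (evaluation x) = rkhs_section H x.
Proof.
apply/eqP; rewrite -subr_eq0 -normr_eq0 -sqrf_eq0 rkhs_normE linearBr/=.
by rewrite -riesz_repP /= rkhs_reproducing subrr.
Qed.

Lemma dual_dot_evaluation x y :
  dual_dot (evaluation x) (evaluation y) = rkhs_kernel x y.
Proof. by rewrite /dual_dot !riesz_rep_evaluation rkhs_kernelE. Qed.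

End RKHS.

(* No d satisfies this when V is infinite-dimensional. *)
Definition has_dim (R : realType) (V : lmodType R) (d : nat) : Prop :=
  exists e : 'I_d -> V,
    forall x : V, exists! c : 'rV[R]_d, x = \sum_(i < d) c 0 i *: e i.

Section LinearSystem.
Variables (R : realType) (X U Y : normedModType R).

Record linear_system := LinearSystem {
  sysA : {linear X -> X};
  sysB : {linear U -> X};
  sysC : {linear X -> Y};
  sysD : {linear U -> Y};
  sysA_continuous : continuous sysA;
  sysB_continuous : continuous sysB;
  sysC_continuous : continuous sysC;
  sysD_continuous : continuous sysD }.

Definition has_order (S : linear_system) (d : nat) : Prop := has_dim X d.

Variable S : linear_system.

Definition controllable : Prop :=
  forall x0 x1 : X, exists (k : nat) (x : nat -> X) (w : nat -> U),
    [/\ x 0%N = x0, x k = x1 &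
        forall i, (i < k)%N -> x i.+1 = sysA S (x i) + sysB S (w i)].

Definition behavior (L : nat) : set (('I_L -> U) * ('I_L -> Y)) :=
  [set wz | exists x : nat -> X, forall i : 'I_L,
     x i.+1 = sysA S (x i) + sysB S (wz.1 i) /\
     wz.2 i = sysC S (x i) + sysD S (wz.1 i)].

End LinearSystem.

Arguments behavior {R X U Y} S L _ : rename.

Section Hankel.
Variables (R : realType) (T : nat).

(* Sequences s_1, ..., s_T are indexed from 0. The number of columns T - L + 1
   is written T.+1 - L, since (T - L).+1 would be 1 when T < L. *)
Lemma hankel_index_proof L (i : 'I_L) (j : 'I_(T.+1 - L)) : (j + i < T)%N.
Proof.
case: L i j => [[]//|L] [i /= iL] [j /=]; rewrite subSS ltn_subRL addnC.
by apply: leq_ltn_trans; rewrite leq_add2l -ltnS.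
Qed.

Definition hankel_index L (i : 'I_L) (j : 'I_(T.+1 - L)) : 'I_T :=
  Ordinal (hankel_index_proof i j).

Definition hankel (V : Type) (L : nat) (s : 'I_T -> V) :
    'M[V]_(L, T.+1 - L) :=
  \matrix_(i, j) s (hankel_index i j).

Definition persistently_exciting (V : lmodType R) (N : nat) (s : 'I_T -> V) :=
  forall w : 'cV[V]_N, exists g : 'cV[R]_(T.+1 - N),
    w = \col_i \sum_j g j 0 *: hankel N s i j.

End Hankel.

Section Trajectories.
Variables (R : realType) (Xu Xy : Type) (Hu : rkhs R Xu) (Hy : rkhs R Xy).

Definition in_behavior (X : normedModType R)
    (S : linear_system X (dual Hu) (dual Hy)) (L : nat)
    (u : 'I_L -> Xu) (y : 'I_L -> Xy) : Prop :=
  behavior S L (fun i => evaluation Hu (u i), fun i => evaluation Hy (y i)).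

Definition traj_space (L : nat) : Type := ('cV[dual Hu]_L * 'cV[dual Hy]_L)%type.

Definition traj_vec (L : nat) (a : 'I_L -> Xu) (b : 'I_L -> Xy) : traj_space L :=
  (\col_i evaluation Hu (a i), \col_i evaluation Hy (b i)).

Definition traj_kernel (L : nat) (v v' : traj_space L) : R :=
  \sum_(i < L) dual_dot (v.1 i 0) (v'.1 i 0) +
  \sum_(i < L) dual_dot (v.2 i 0) (v'.2 i 0).

Lemma traj_kernelE (L : nat) (a a' : 'I_L -> Xu) (b b' : 'I_L -> Xy) :
  traj_kernel (traj_vec a b) (traj_vec a' b') =
  \sum_(i < L) rkhs_kernel Hu (a i) (a' i) +
  \sum_(i < L) rkhs_kernel Hy (b i) (b' i).
Proof.
by congr (_ + _); apply: eq_bigr => i _; rewrite !mxE dual_dot_evaluation.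
Qed.

(* The j-th column of the Hankel matrix of the inputs stacked on top of that of
   the outputs. *)
Definition stacked_hankel_col (T L : nat) (u : 'I_T -> Xu) (y : 'I_T -> Xy)
    (j : 'I_(T.+1 - L)) : traj_space L :=
  (col j (hankel L (fun i => evaluation Hu (u i))),
   col j (hankel L (fun i => evaluation Hy (y i)))).

Lemma stacked_hankel_colE (T L : nat) (u : 'I_T -> Xu) (y : 'I_T -> Xy)
    (j : 'I_(T.+1 - L)) :
  stacked_hankel_col u y j =
  traj_vec (fun i => u (hankel_index i j)) (fun i => y (hankel_index i j)).
Proof. by congr pair; apply/colP => i; rewrite !mxE. Qed.

End Trajectories.

Definition gram (R : realType) (V : Type) (n : nat) (k : V -> V -> R)
    (v : 'I_n -> V) : 'M[R]_n :=
  \matrix_(i, j) k (v i) (v j).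

(* Main.v *)
Require Import Defs.
From HB Require Import structures.
From mathcomp Require Import all_boot all_order all_algebra.
From mathcomp Require Import all_classical all_reals all_analysis.
From mathcomp Require Import ring zify.

(** The Gram-matrix expression is the squared norm of [vt - \sum_j g_j v_j], so
    it vanishes iff [vt] is a combination of the columns of the Hankel matrix.
    Every combination of columns is a trajectory; the converse is Willems'
    fundamental lemma: under controllability and persistency of excitation the
    pairs (input window, initial state) taken from the data span all such pairs.

    This is proved without duality.  Let [\sum_(k <= d) alpha_k A^k = 0] with
    [alpha_d = 1] (Cayley-Hamilton).  Excitation realizes any input [w] of
    length [d + L] as a combination of data windows, with some uncontrolled
    initial state.  Summing the [d + 1] time shifts of this combination with
    weights [alpha_k] cancels the contribution of that state: the result is the
    pair with inputs [\sum_k alpha_k w_(k+i)] and state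
    [\sum_k alpha_k x_k(w)], where [x_k(w)] is reached from [0].  The states so
    obtained form an [A]-invariant subspace containing the range of [B], hence
    everything, and depend only on the first [d] inputs; as [alpha_d = 1], the
    remaining [L] inputs can be solved for to match any prescribed window. *)

Set Implicit Arguments.
Unset Strict Implicit.
Unset Printing Implicit Defensive.

Import Order.TTheory GRing.Theory Num.Theory.
Import numFieldNormedType.Exports.

Local Open Scope ring_scope.

(** * State response to an input, and its filtering by an annihilating polynomial *)

Section StateResponse.
Variables (F : comNzRingType) (X U : lmodType F).
Variables (A : {linear X -> X}) (B : {linear U -> X}).

Fixpoint state (w : nat -> U) (x : X) (k : nat) : X :=
  if k is k'.+1 then A (state w x k') + B (w k') else x.

Lemma eq_state w w' x k :
  (forall m, (m < k)%N -> w m = w' m) -> state w x k = state w' x k.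
Proof.
elim: k => //= k IH ww'; rewrite ww'// IH// => m mk.
by apply: ww'; rewrite ltnW.
Qed.

Lemma state_linear a w w' x x' k :
  state (fun m => a *: w m + w' m) (a *: x + x') k =
  a *: state w x k + state w' x' k.
Proof. by elim: k => //= k ->; rewrite !linearP/= scalerDr addrACA. Qed.

Lemma state0 k : state (fun=> 0) 0 k = 0.
Proof. by elim: k => //= k ->; rewrite !linear0 addr0. Qed.

Lemma state_free w x k : state w x k = iter k A x + state w 0 k.
Proof. by elim: k => [|k /= ->]; rewrite /= ?addr0// linearD addrA. Qed.

Lemma state_shift w x k : state (w \o succn) (A x + B (w 0)) k = state w x k.+1.
Proof. by elim: k => //= k ->. Qed.

Lemma state_sum (I : finType) (c : I -> F) (w : I -> nat -> U)
    (x : I -> nat -> X) k :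
  (forall i m, (m < k)%N -> x i m.+1 = A (x i m) + B (w i m)) ->
  \sum_i c i *: x i k =
  state (fun m => \sum_i c i *: w i m) (\sum_i c i *: x i 0%N) k.
Proof.
elim: k => //= k IH xS; rewrite -IH => [|i m mk]; last by rewrite xS// ltnW.
rewrite !linear_sum -big_split/=; apply: eq_bigr => i _.
by rewrite xS// scalerDr !linearZ.
Qed.

Section Annihilated.
Variables (d : nat) (alpha : nat -> F).
Hypothesis alpha_d : alpha d = 1.
Hypothesis annihilates :
  forall x, \sum_(k < d.+1) alpha k *: iter k A x = 0.

Definition filtered_state (w : nat -> U) : X :=
  \sum_(k < d.+1) alpha k *: state w 0 k.

(** The free response [iter k A x] is annihilated, so the initial state does not matter. *)
Lemma filtered_stateE w x :
  \sum_(k < d.+1) alpha k *: state w x k = filtered_state w.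
Proof.
under eq_bigr do rewrite state_free scalerDr.
by rewrite big_split/= annihilates add0r.
Qed.

Lemma eq_filtered_state w w' :
  (forall m, (m < d)%N -> w m = w' m) -> filtered_state w = filtered_state w'.
Proof.
move=> ww'; apply: eq_bigr => k _; congr (_ *: _); apply: eq_state => m mk.
by apply: ww'; apply: leq_trans mk _; rewrite -ltnS.
Qed.

Lemma filtered_state_linear a w w' :
  filtered_state (fun m => a *: w m + w' m) =
  a *: filtered_state w + filtered_state w'.
Proof.
rewrite /filtered_state scaler_sumr -big_split/=; apply: eq_bigr => k _.
have := state_linear a w w' 0 0 k; rewrite scaler0 addr0 => ->.
by rewrite scalerDr !scalerA mulrC.
Qed.

(** One step from state 0 leads to [A 0 + B (w 0)]; starting the shifted input there advances every
    term by one step. *)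
Lemma filtered_state_shift w :
  filtered_state (w \o succn) =
  A (filtered_state w) + B (\sum_(k < d.+1) alpha k *: w k).
Proof.
rewrite -(filtered_stateE _ (A 0 + B (w 0))) !linear_sum -big_split/=.
by apply: eq_bigr => k _; rewrite state_shift scalerDr !linearZ.
Qed.

(** An impulse at time [d - 1] reaches only the term [k = d], of weight 1. For [d = 0],
    [annihilates] makes every state 0. *)
Lemma filtered_state_input z : exists w, filtered_state w = B z.
Proof.
exists (fun m => if m.+1 == d then z else 0); rewrite /filtered_state.
case: d alpha_d annihilates => [|e] alpha_e an.
  by have := an (B z); rewrite !big_ord1/= alpha_e !scale1r.
rewrite big_ord_recr/= alpha_e scale1r eqxx big1 ?add0r => [|k _].
  rewrite (@eq_state _ (fun=> 0)) ?state0 ?linear0 ?add0r// => m me.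
  by rewrite eqSS ltn_eqF.
rewrite (@eq_state _ (fun=> 0)) ?state0 ?scaler0// => m mk.
by rewrite ltn_eqF// (leq_ltn_trans mk).
Qed.

Lemma filtered_state_reachable (x : nat -> X) (w : nat -> U) k :
  x 0%N = 0 -> (forall i, (i < k)%N -> x i.+1 = A (x i) + B (w i)) ->
  exists w', filtered_state w' = x k.
Proof.
move=> x0; elim: k => [_|k IH xS].
  exists (fun=> 0); rewrite x0 /filtered_state big1// => k _.
  by rewrite state0 scaler0.
have [w1 w1x] := IH (fun i ik => xS i (ltnW ik)).
(* Shifting [w1] applies [A] but injects the filtered input of [w1]; [w2] replaces that input by
   [w k]. *)
have [w2 w2B] := filtered_state_input
  (w k - \sum_(j < d.+1) alpha j *: w1 j).
exists (fun m => 1 *: w2 m + (w1 \o succn) m).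
rewrite filtered_state_linear scale1r filtered_state_shift w1x w2B.
by rewrite xS// [RHS]addrC linearB/= addrCA subrK addrC.
Qed.

(** Equation [i] involves inputs up to time [d + i], the last with coefficient 1, so the equations
    are solved in turn. *)
Lemma extend_input (w0 s : nat -> U) L : exists w,
  (forall m, (m < d)%N -> w m = w0 m) /\
  (forall i, (i < L)%N -> \sum_(k < d.+1) alpha k *: w (k + i)%N = s i).
Proof.
elim: L => [|L [w [ww0 ws]]]; first by exists w0.
pose z := s L - \sum_(k < d) alpha k *: w (k + L)%N.
exists (fun m => if m == (d + L)%N then z else w m); split=> [m md|i].
  by rewrite ltn_eqF ?ww0// ltn_addr.
rewrite ltnS leq_eqVlt => /predU1P[->|iL].
  rewrite big_ord_recr/= eqxx alpha_d scale1r addrC /z.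
  rewrite [X in _ + X](eq_bigr (fun k : 'I_d => alpha k *: w (k + L)%N)).
    by rewrite subrK.
  move=> k _.
  by rewrite eqn_add2r ltn_eqF.
rewrite -ws//; apply: eq_bigr => k _; rewrite ltn_eqF//.
by rewrite -addnS leq_add// -ltnS.
Qed.

End Annihilated.
End StateResponse.

(** * A monic annihilating polynomial from Cayley-Hamilton *)

Lemma char_poly_sum (F : comNzRingType) n (M : 'M[F]_n.+1) :
  \sum_(k < n.+2) (char_poly M)`_k *: M ^+ k = 0.
Proof.
rewrite -[RHS](Cayley_Hamilton M) -[in RHS](coefK (char_poly M)) poly_def.
rewrite size_char_poly [RHS]raddf_sum; apply: eq_bigr => k _.
by rewrite /= linearZ/= rmorphXn/= horner_mx_X.
Qed.

Lemma has_dim_annihilator (R : realType) (V : lmodType R)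
    (A : {linear V -> V}) d : has_dim V d ->
  exists alpha : nat -> R, alpha d = 1 /\
    forall x, \sum_(k < d.+1) alpha k *: iter k A x = 0.
Proof.
case: d => [|d] [e eP].
  exists (fun=> 1); split=> // x; have [c [-> _]] := eP x.
  by rewrite big_ord1/= scale1r big_ord0.
pose phi (c : 'rV[R]_d.+1) := \sum_(i < d.+1) c 0 i *: e i.
have /choice[m mP] : forall i, exists c, A (e i) = phi c.
  by move=> i; have [c [Ac _]] := eP (A (e i)); exists c.
(* Coordinates are row vectors, so [A] acts by multiplication by [M] on the right. *)
pose M : 'M[R]_d.+1 := \matrix_i m i.
have AM c : A (phi c) = phi (c *m M).
  rewrite linear_sum/=; under eq_bigr do rewrite linearZ/= mP scaler_sumr.
  rewrite exchange_big/=; apply: eq_bigr => i _; rewrite mxE scaler_suml.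
  by apply: eq_bigr => j _; rewrite scalerA mxE.
have phi_sum (I : finType) (a : I -> R) (c : I -> 'rV[R]_d.+1) :
    \sum_i a i *: phi (c i) = phi (\sum_i a i *: c i).
  under eq_bigr do rewrite scaler_sumr.
  rewrite exchange_big/=; apply: eq_bigr => i _; rewrite summxE scaler_suml.
  by apply: eq_bigr => j _; rewrite mxE scalerA.
exists (fun k => (char_poly M)`_k); split.
  by have /monicP := char_poly_monic M; rewrite /lead_coef size_char_poly.
move=> x; have [c [-> _]] := eP x; rewrite -/(phi c).
have iterM k : iter k A (phi c) = phi (c *m M ^+ k).
  elim: k => [|k /= ->]; first by rewrite expr0 mulmx1.
  by rewrite AM -mulmxA exprSr.
under eq_bigr do rewrite iterM.
rewrite phi_sum; under eq_bigr do rewrite scalemxAr.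
rewrite -mulmx_sumr.
rewrite char_poly_sum mulmx0.
by apply: big1 => i _; rewrite mxE scale0r.
Qed.

(** * Willems' fundamental lemma *)

Lemma fundamental_lemma (R : realType) (X U : lmodType R)
    (A : {linear X -> X}) (B : {linear U -> X}) (d T L N : nat)
    (u : 'I_T -> U) (x : nat -> X) (w : 'I_L -> U) (z : X) :
  has_dim X d -> (d + L <= N)%N -> persistently_exciting N u ->
  (forall i : 'I_T, x i.+1 = A (x i) + B (u i)) ->
  (exists k (xz : nat -> X) (wz : nat -> U),
    [/\ xz 0%N = 0, xz k = z &
        forall i, (i < k)%N -> xz i.+1 = A (xz i) + B (wz i)]) ->
  exists g : 'cV[R]_(T.+1 - L),
    (forall i, \sum_j g j 0 *: u (hankel_index i j) = w i) /\
    \sum_j g j 0 *: x j = z.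
Proof.
move=> /(has_dim_annihilator A)[alpha [alpha_d an]] dLN pe xS.
case=> k [xz [wz [xz0 <- {z}xzS]]].
have [w0 w0z] := filtered_state_reachable alpha_d an xz0 xzS.
(* Padding by 0 allows indexing by [nat]; [extE] is only applied inside the range. *)
pose ext n (s : 'I_n -> U) m := if insub m is Some i then s i else 0.
have extE n (s : 'I_n -> U) (i : 'I_n) m : i = m :> nat -> ext n s m = s i.
  by move=> <-; rewrite /ext valK.
have [w1 [w1w0 w1w]] := extend_input alpha_d w0 (ext L w) L.
have [g gw1] := pe (\col_i w1 i).
have {}gw1 i : (i < N)%N -> \sum_j g j 0 *: ext T u (j + i)%N = w1 i.
  move=> iN; have /colP/(_ (Ordinal iN)) := gw1; rewrite !mxE/= => ->.
  apply: eq_bigr => j _; rewrite mxE; congr (_ *: _).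
  by apply: extE.
pose x0 := \sum_j g j 0 *: x j.
have gx k' : (k' <= d)%N -> \sum_j g j 0 *: x (j + k')%N = state A B w1 x0 k'.
  move=> kd.
  have -> : x0 = \sum_j g j 0 *: x (j + 0)%N.
    by apply: eq_bigr => j _; rewrite addn0.
  rewrite (state_sum (A := A) (B := B) _ (x := fun j m => x (j + m)%N)
    (w := fun (j : 'I__) m => ext T u (j + m)%N)); last first.
    move=> j m mk; have jmT : (j + m < T)%N by have := ltn_ord j; lia.
    by rewrite (extE _ _ (Ordinal jmT))// addnS (xS (Ordinal jmT)).
  by apply: eq_state => m mk; apply: gw1; lia.
(* The convolution of [alpha] and [g]: the weighted sum of the time shifts of [g]. Its support fits
   in [T.+1 - L] columns because [d + L <= N]. *)
pose h : 'cV[R]_(T.+1 - L) := \col_m \sum_(k' < d.+1) \sum_(j < T.+1 - N)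
  if (j + k' == m)%N then alpha k' * g j 0 else 0.
have hE (V : lmodType R) (s : nat -> V) : \sum_m h m 0 *: s m =
    \sum_(k' < d.+1) alpha k' *: \sum_j g j 0 *: s (j + k')%N.
  under eq_bigr do rewrite mxE scaler_suml.
  rewrite exchange_big/=; apply: eq_bigr => k' _.
  under eq_bigr do rewrite scaler_suml.
  rewrite exchange_big/= scaler_sumr; apply: eq_bigr => j _.
  have jk : (j + k' < T.+1 - L)%N.
    by have := ltn_ord j; have := ltn_ord k'; lia.
  rewrite (bigD1 (Ordinal jk))//= eqxx scalerA big1 ?addr0// => m mjk.
  by rewrite ifN ?scale0r//; apply: contraNneq mjk => jkm; exact/eqP/val_inj.
exists h; split=> [i|].
  rewrite -(extE _ w i i erefl) -w1w//.
  transitivity (\sum_m h m 0 *: ext T u (m + i)%N).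
    apply: eq_bigr => m _; congr (_ *: _).
    by rewrite (extE _ _ (hankel_index i m)).
  rewrite (hE _ (fun m => ext T u (m + i)%N)); apply: eq_bigr => k' _.
  rewrite -gw1; last by have := ltn_ord k'; have := ltn_ord i; lia.
  by under eq_bigr do rewrite -addnA.
(* Here the uncontrolled initial state [x0] drops out. *)
rewrite hE -w0z -(eq_filtered_state _ _ _ w1w0) -(filtered_stateE _ an _ x0).
by apply: eq_bigr => k' _; rewrite gx// -ltnS.
Qed.

(** * Inner product on the dual, and the Gram expression as a squared norm *)

Section DualDot.
Variables (R : realType) (X : Type) (H : rkhs R X).

(** The defect of linearity is orthogonal to every vector, in particular to itself. This makes
    [dual_dot] bilinear. *)
Lemma riesz_rep_linear : linear (@riesz_rep R X H).
Proof.
move=> a f g; apply/eqP; rewrite -subr_eq0 -normr_eq0 -sqrf_eq0 rkhs_normE.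
rewrite linearBr/= linearDr/= linearZr_LR/= -!riesz_repP.
by rewrite dualDE dualZE subrr.
Qed.

HB.instance Definition _ :=
  GRing.isLinear.Build R (dual H) H *:%R (@riesz_rep R X H) riesz_rep_linear.

Lemma dual_dot_ge0 (f : dual H) : 0 <= dual_dot f f.
Proof. by rewrite /dual_dot -rkhs_normE exprn_ge0. Qed.

Lemma dual_dot_eq0 (f : dual H) : dual_dot f f = 0 -> f = 0.
Proof.
move=> /eqP; rewrite /dual_dot -rkhs_normE sqrf_eq0 normr_eq0 => /eqP f0.
by apply/val_inj/funext => h /=; rewrite riesz_repP f0 linear0r.
Qed.

Lemma dual_dot_sub_sum (f : dual H) n (g : 'I_n -> R) (h : 'I_n -> dual H) :
  dual_dot (f - \sum_j g j *: h j) (f - \sum_j g j *: h j) =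
  \sum_i \sum_j g i * g j * dual_dot (h i) (h j) + dual_dot f f
    - 2 * \sum_j g j * dual_dot f (h j).
Proof.
have sumr (a : dual H) : dual_dot a (\sum_j g j *: h j) =
    \sum_j g j * dual_dot a (h j).
  rewrite /dual_dot !linear_sum/=.
  by apply: eq_bigr => j _; rewrite linearZ/= linearZr_LR.
have sumsum : dual_dot (\sum_j g j *: h j) (\sum_j g j *: h j) =
    \sum_i \sum_j g i * g j * dual_dot (h i) (h j).
  rewrite sumr; apply: eq_bigr => i _.
  rewrite /dual_dot rkhs_dotC -/(dual_dot _ _) sumr mulr_sumr.
  by apply: eq_bigr => j _; rewrite mulrA.
rewrite -sumsum -sumr /dual_dot linearB/= linearBl/= !linearBr/=.
rewrite (rkhs_dotC (riesz_rep (\sum_j _)) (riesz_rep f)).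
ring.
Qed.

End DualDot.

(** Each square is expanded; moving the sum over components inside reassembles [traj_kernel]. *)
Lemma gram_formE (R : realType) (Xu Xy : Type) (Hu : rkhs R Xu)
    (Hy : rkhs R Xy) L n (v : 'I_n -> traj_space Hu Hy L)
    (vt : traj_space Hu Hy L) (g : 'cV[R]_n) :
  let du i := vt.1 i 0 - \sum_j g j 0 *: (v j).1 i 0 in
  let dy i := vt.2 i 0 - \sum_j g j 0 *: (v j).2 i 0 in
  (g^T *m gram (@traj_kernel R _ _ Hu Hy L) v *m g) 0 0 + traj_kernel vt vt
    - 2 * (\sum_i g i 0 * traj_kernel vt (v i)) =
  \sum_i dual_dot (du i) (du i) + \sum_i dual_dot (dy i) (dy i).
Proof.
move=> du dy; rewrite /du /dy.
under [\sum_i dual_dot (_ - \sum_j _ *: (v j).1 i 0) _]eq_bigr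
  do rewrite dual_dot_sub_sum.
under [\sum_i dual_dot (_ - \sum_j _ *: (v j).2 i 0) _]eq_bigr
  do rewrite dual_dot_sub_sum.
rewrite !sumrB !big_split/= -!mulr_sumr.
have quad : (g^T *m gram (@traj_kernel R _ _ Hu Hy L) v *m g) 0 0 =
    \sum_i \sum_j \sum_k
      g j 0 * g k 0 * dual_dot ((v j).1 i 0) ((v k).1 i 0) +
    \sum_i \sum_j \sum_k
      g j 0 * g k 0 * dual_dot ((v j).2 i 0) ((v k).2 i 0).
  rewrite mxE; under eq_bigr do rewrite mxE mulr_suml.
  rewrite exchange_big/= [X in _ = X + _]exchange_big/=.
  rewrite [X in _ = _ + X]exchange_big/= -big_split/=; apply: eq_bigr => j _.
  rewrite [X in _ = X + _]exchange_big/= [X in _ = _ + X]exchange_big/=.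
  rewrite -big_split/=; apply: eq_bigr => k _.
  by rewrite -!mulr_sumr -mulrDr !mxE mulrAC.
have cross : \sum_j g j 0 * traj_kernel vt (v j) =
    \sum_i \sum_j g j 0 * dual_dot (vt.1 i 0) ((v j).1 i 0) +
    \sum_i \sum_j g j 0 * dual_dot (vt.2 i 0) ((v j).2 i 0).
  rewrite [X in _ = X + _]exchange_big/= [X in _ = _ + X]exchange_big/=.
  by rewrite -big_split/=; apply: eq_bigr => j _; rewrite -!mulr_sumr -mulrDr.
rewrite quad cross /traj_kernel; ring.
Qed.

Lemma gram_form_eq0 (R : realType) (Xu Xy : Type) (Hu : rkhs R Xu)
    (Hy : rkhs R Xy) L n (v : 'I_n -> traj_space Hu Hy L)
    (vt : traj_space Hu Hy L) (g : 'cV[R]_n) :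
  (g^T *m gram (@traj_kernel R _ _ Hu Hy L) v *m g) 0 0 + traj_kernel vt vt
    - 2 * (\sum_i g i 0 * traj_kernel vt (v i)) = 0 <->
  forall i, vt.1 i 0 = \sum_j g j 0 *: (v j).1 i 0 /\
            vt.2 i 0 = \sum_j g j 0 *: (v j).2 i 0.
Proof.
rewrite gram_formE; split=> [/eqP|vtE]; last first.
  rewrite !big1 ?addr0// => i _; have [uE yE] := vtE i.
    by rewrite -yE subrr /dual_dot linear0 linear0r.
  by rewrite -uE subrr /dual_dot linear0 linear0r.
rewrite paddr_eq0; try by apply: sumr_ge0 => i _; exact: dual_dot_ge0.
rewrite !psumr_eq0; try by move=> i _; exact: dual_dot_ge0.
move=> /andP[/allP u0 /allP y0] i; split; apply/eqP;
  rewrite -subr_eq0; apply/eqP.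
  by apply: dual_dot_eq0; exact/eqP/(u0 i)/mem_index_enum.
by apply: dual_dot_eq0; exact/eqP/(y0 i)/mem_index_enum.
Qed.

Theorem theorem4 (R : realType) (X : Type) (nu ny : nat)
  (Hx : rkhs R X) (Hu : rkhs R 'rV[R]_nu) (Hy : rkhs R 'rV[R]_ny)
  (S : linear_system (dual Hx) (dual Hu) (dual Hy))
  (T L N d : nat) (u : 'I_T -> 'rV[R]_nu) (y : 'I_T -> 'rV[R]_ny)
  (v := @stacked_hankel_col R _ _ Hu Hy T L u y)
  (K := gram (@traj_kernel R _ _ Hu Hy L) v)
  (ut : 'I_L -> 'rV[R]_nu) (yt : 'I_L -> 'rV[R]_ny)
  (vt := traj_vec Hu Hy ut yt)
  (hnu : (0 < nu)%N) (hL : (0 < L)%N)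
  (hS : controllable S)
  (hmeas : in_behavior S u y)
  (hd : has_order S d)
  (hN : (d + L * nu <= N)%N)
  (hpe : persistently_exciting N (fun i => evaluation Hu (u i))) :
  in_behavior S ut yt <->
  exists g : 'cV[R]_(T.+1 - L),
    (g^T *m K *m g) 0 0 + traj_kernel vt vt
      - 2 * (\sum_i g i 0 * traj_kernel vt (v i)) = 0.
Proof.
case: hmeas => x /= xS.
(* By linearity, a combination of data windows is a trajectory, driven through the same combination
   of measured states. *)
have comb (g : 'cV[R]_(T.+1 - L)) (i : 'I_L) :
    \sum_j g j 0 *: x (j + i.+1)%N =
    sysA S (\sum_j g j 0 *: x (j + i)%N) +
    sysB S (\sum_j g j 0 *: evaluation Hu (u (hankel_index i j))) /\
    \sum_j g j 0 *: evaluation Hy (y (hankel_index i j)) =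
    sysC S (\sum_j g j 0 *: x (j + i)%N) +
    sysD S (\sum_j g j 0 *: evaluation Hu (u (hankel_index i j))).
  rewrite !linear_sum -!big_split/=; split; apply: eq_bigr => j _;
    rewrite !linearZ/= -scalerDr; have [xE yE] := xS (hankel_index i j).
    by rewrite addnS xE.
  by rewrite yE.
have vE (g : 'cV[R]_(T.+1 - L)) i :
    \sum_j g j 0 *: (v j).1 i 0 =
      \sum_j g j 0 *: evaluation Hu (u (hankel_index i j)) /\
    \sum_j g j 0 *: (v j).2 i 0 =
      \sum_j g j 0 *: evaluation Hy (y (hankel_index i j)).
  by split; apply: eq_bigr => j _; rewrite !mxE.
split=> [[xt /= xtS]|[g /gram_form_eq0 vtE]]; last first.
  exists (fun i => \sum_j g j 0 *: x (j + i)%N) => i /=.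
  have [] := vtE i; have [-> ->] := vE g i; rewrite !mxE => -> ->.
  exact: comb.
(* Uses [L <= L * nu], from [hnu]. *)
have dLN : (d + L <= N)%N.
  by apply: leq_trans hN; rewrite leq_add2l leq_pmulr.
(* The state to match is the initial state [xt 0] of the given trajectory, steered to from 0. *)
have [g [gu gx]] := fundamental_lemma (fun i => evaluation Hu (ut i)) hd dLN
  hpe (fun i => (xS i).1) (hS 0 (xt 0%N)).
exists g; apply/gram_form_eq0 => i; have [-> ->] := vE g i; rewrite !mxE.
(* Equal initial states and inputs force equal states, hence equal outputs. *)
have gxt k : (k <= L)%N -> \sum_j g j 0 *: x (j + k)%N = xt k.
  elim: k => [_|k IH kL].
    by rewrite -gx; apply: eq_bigr => j _; rewrite addn0.
  have [/= -> _] := comb g (Ordinal kL).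
  by rewrite gu (IH (ltnW kL)) (xtS (Ordinal kL)).1.
split; first by rewrite gu.
by rewrite (comb g i).2 gu gxt ?(xtS i).2// ltnW.
Qed.
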